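(* Let $g_\alpha$ (the distribution of a generative model) and $\mu$ (the real distribution) be probability distributions on a sample space $X$, and let $r=d_{\mathrm{TV}}(g_\alpha,\mu)$ be their total variation distance. Define $f:[0,1]\to[0,1]$ by $$f(x)=\begin{cases}x+r & (0\le x\le 1-r)\\ 1 & (1-r<x\le 1).\end{cases}$$ Then for every membership inference attack policy $\mathcal{A}$, its ROC curve $g_{\mathcal{A}}:[0,1]\to[0,1]$ (mapping false positive rate to true positive rate) satisfies $g_{\mathcal{A}}(x)\le f(x)$ for all $0\le x\le1$. Moreover this bound is tight: there exist two distributions $\mu',g'$ with $d_{\mathrm{TV}}(\mu',g')=r$ and an attack policy for $(g',\mu')$ whose ROC curve is exactly $f$ at every point.
   Context: Total variation distance: $d_{\mathrm{TV}}(\mu,\nu)=\sup_S|\mu(S)-\nu(S)|$ over measurable $S$. Membership inference attack: given a single test sample $x\in X$ and full knowledge of the generated distribution, the attacker decides whether $x$ came from the training set, whose posterior distribution is modeled as $g_\alpha$ (positive), or from $\mu$ (negative). Thus an attack for the pair $(g_\alpha,\mu)$ is a (possibly randomized) test, i.e. a measurable $\phi:X\to[0,1]$, $\phi(x)$ being the probability of declaring ''positive''; its true positive rate is $\mathrm{TP}=\mathbb{E}_{x\sim g_\alpha}[\phi(x)]$ and its false positive rate is $\mathrm{FP}=\mathbb{E}_{x\sim\mu}[\phi(x)]$. An attack policy $\mathcal{A}$ provides for each $x\in[0,1]$ a test with $\mathrm{FP}=x$, and $g_{\mathcal{A}}(x)$ is the true positive rate of that test. *)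

(* Defs.v *)
From HB Require Import structures.
From mathcomp Require Import all_boot all_order all_algebra.
From mathcomp Require Import all_classical all_reals all_analysis.
Set Implicit Arguments.
Unset Strict Implicit.
Unset Printing Implicit Defensive.
Import Order.TTheory GRing.Theory Num.Theory.
Local Open Scope classical_set_scope.
Local Open Scope ring_scope.

(* The set is nonempty and bounded above by 1, so the real supremum is the
   genuine one. *)
Definition dTV (d : measure_display) (X : measurableType d) (R : realType)
    (P Q : probability X R) : R :=
  sup [set `|fine (P S) - fine (Q S)| | S in [set S : set X | measurable S]].

(* A randomized test: [phi z] is the probability of answering "positive"
   on the sample [z]. *)
Definition is_test (d : measure_display) (X : measurableType d) (R : realType)
    (phi : X -> R) : Prop :=
  measurable_fun [set: X] phi /\ (forall z, 0 <= phi z <= 1).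

(* On tests the expectation lies in [0, 1], so [fine] loses nothing. *)
Definition true_positive_rate (d : measure_display) (X : measurableType d)
    (R : realType) (g : probability X R) (phi : X -> R) : R :=
  fine ('E_g[phi])%E.

Definition false_positive_rate (d : measure_display) (X : measurableType d)
    (R : realType) (mu : probability X R) (phi : X -> R) : R :=
  fine ('E_mu[phi])%E.

(* The attacker knows both distributions, so a policy for the pair (g, mu) is
   any family of tests indexed by the false positive rate; the values of [A]
   outside [0, 1] are irrelevant, and the conditions involve only [mu]. *)
Definition is_attack_policy (d : measure_display) (X : measurableType d)
    (R : realType) (mu : probability X R) (A : R -> X -> R) : Prop :=
  forall x : R, 0 <= x <= 1 ->
    is_test (A x) /\ false_positive_rate mu (A x) = x.

Definition roc_curve (d : measure_display) (X : measurableType d)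
    (R : realType) (g : probability X R) (A : R -> X -> R) (x : R) : R :=
  true_positive_rate g (A x).

Definition roc_bound (R : realType) (r x : R) : R :=
  if x <= 1 - r then x + r else 1.

(* Main.v *)
(** Upper bound: by the layer-cake formula [E[phi]] is the integral over
    [t >= 0] of the mass of [{phi > t}].  The two masses differ by at most [r]
    for [t < 1] and vanish for [t >= 1], so the two expectations differ by at
    most [r].

    Tightness: both distributions put mass [1 - r] on a common atom, and each
    puts its remaining mass [r] on an atom of its own.  The optimal test answers
    "positive" on the private atom of [g'], then spends its false positive budget
    on the common atom, and only last on the private atom of [mu']. *)
Require Import Defs.
From HB Require Import structures.
From mathcomp Require Import all_boot all_order all_algebra.
From mathcomp Require Import all_classical all_reals all_analysis.
From mathcomp Require Import measurable_realfun ring lra.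
Set Implicit Arguments.
Unset Strict Implicit.
Unset Printing Implicit Defensive.
Import Order.TTheory GRing.Theory Num.Theory.
Local Open Scope classical_set_scope.
Local Open Scope ring_scope.

Section total_variation.
Context (d : measure_display) (X : measurableType d) (R : realType).
Implicit Types (P Q : probability X R) (S : set X) (phi : X -> R).

Lemma fine_probability_itv P S : measurable S -> 0 <= fine (P S) <= 1.
Proof.
move=> mS; rewrite fine_ge0//= -[leRHS]/(fine (1%:E : \bar R)).
by rewrite fine_le ?fin_num_measure// probability_le1.
Qed.

Lemma dTV_has_sup P Q : has_sup
  [set `|fine (P S) - fine (Q S)| | S in [set S : set X | measurable S]].
Proof.
split; first by eexists; exists set0 => //=.
exists 1 => _ [S mS <-]; rewrite ler_norml.
by have := fine_probability_itv P mS; have := fine_probability_itv Q mS; lra.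
Qed.

Lemma le_dTV P Q S : measurable S -> `|fine (P S) - fine (Q S)| <= dTV P Q.
Proof. by move=> mS; apply: sup_upper_bound; [exact: dTV_has_sup|exists S]. Qed.

Lemma dTV_le P Q (c : R) :
  (forall S, measurable S -> `|fine (P S) - fine (Q S)| <= c) -> dTV P Q <= c.
Proof.
by move=> PQc; apply: ge_sup => [|_ [S mS <-]]; [case: (dTV_has_sup P Q)|exact: PQc].
Qed.

Lemma dTV_itv P Q : 0 <= dTV P Q <= 1.
Proof.
rewrite (le_trans _ (le_dTV P Q measurable0))//=; apply: dTV_le => S mS.
rewrite ler_norml.
by have := fine_probability_itv P mS; have := fine_probability_itv Q mS; lra.
Qed.

(** One-sided form in the extended reals, ready for comparing the two layer-cake integrands
    pointwise. *)
Lemma probability_le_dTV P Q S : measurable S -> (P S <= Q S + (dTV P Q)%:E)%E.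
Proof.
move=> mS; rewrite -(fineK (fin_num_measure P _ mS)).
rewrite -(fineK (fin_num_measure Q _ mS)) -EFinD lee_fin -lerBlDl.
exact: le_trans (ler_norm _) (le_dTV P Q mS).
Qed.

Lemma test_expectation_itv P phi : is_test phi -> (0 <= 'E_P[phi] <= 1)%E.
Proof.
move=> [mphi phi01]; have phi0 z : 0 <= phi z by case/andP: (phi01 z).
rewrite expectation_ge0//= -[leRHS](expectation_cst P 1).
apply: expectation_le => //; apply/aeW => z.
by case/andP: (phi01 z).
Qed.

Lemma test_expectation_fin_num P phi : is_test phi -> 'E_P[phi]%E \is a fin_num.
Proof.
move=> /(test_expectation_itv P) /andP[E0 E1].
by rewrite ge0_fin_numE// (le_lt_trans E1) ?ltry.
Qed.

Lemma expectation_le_dTV P Q phi : is_test phi ->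
  ('E_P[phi] <= 'E_Q[phi] + (dTV P Q)%:E)%E.
Proof.
move=> [mphi phi01]; have phi0 z : 0 <= phi z by case/andP: (phi01 z).
pose Y : {mfun X >-> R} := mfun_Sub (mem_set mphi).
have YE : phi = Y by [].
rewrite YE (ge0_expectation_ccdf (P := P))// (ge0_expectation_ccdf (P := Q))//.
pose c := dTV P Q; have /andP[c0 _] : 0 <= c <= 1 := dTV_itv P Q.
(* Writing [c] as the integral of [c] times the indicator of [[0, 1[] lets both sides be compared
   under one integral sign. The interval may stop before 1, since [phi > t] is impossible once
   [t >= 1]. *)
have -> : c%:E = (\int[lebesgue_measure]_(t in `[0%R, +oo[)
    (c%:E * (\1_(`[0%R, 1%R[%classic) t)%:E))%E :> \bar R.
  rewrite ge0_integralZl//; last first.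
    exact/measurable_EFinP/measurable_indic.
  rewrite integral_indic// setIidl; last first.
    by move=> t /=; rewrite !in_itv/= => /andP[->].
  by rewrite /= lebesgue_measure_itv/= lte_fin ltr01 oppr0 adde0 mule1.
have mccdf (P' : probability X R) :
    measurable_fun (`[0%R, +oo[%classic : set R) (ccdf (P := P') Y).
  by apply: measurable_funTS; exact: ccdf_measurable.
have mind : measurable_fun (`[0%R, +oo[%classic : set R)
    (fun t => c%:E * (\1_(`[0%R, 1%R[%classic) t)%:E)%E.
  by apply: measurable_funeM; exact/measurable_EFinP/measurable_indic.
rewrite -ge0_integralD//; last 2 first.
- exact: mccdf.
- by move=> t _; rewrite -EFinM lee_fin mulr_ge0.
apply: ge0_le_integral => //.
- exact: mccdf.
- by apply: emeasurable_funD; [exact: mccdf|exact: mind].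
move=> t /=; rewrite in_itv/= andbT => t0.
have [t1|t1] := ltP t 1.
  rewrite indicE mem_set/= ?mule1; last by rewrite in_itv/= t0.
  by apply: probability_le_dTV; exact: measurable_funPTI.
rewrite indicE memNset/=; last by rewrite in_itv/= t0 ltNge t1.
rewrite mule0 adde0 /ccdf /distribution /pushforward.
suff -> : Y @^-1` `]t, +oo[ = set0 by rewrite !measure0.
apply/seteqP; split => // z /=; rewrite in_itv/= andbT.
move=> /(le_lt_trans t1); rewrite ltNge => /negP; apply.
by case/andP: (phi01 z).
Qed.

End total_variation.

(** Each branch of [roc_bound] is one of two bounds that always hold: ['E_g[phi]] is at most
    ['E_mu[phi] + dTV g mu], and at most 1. *)
Lemma test_roc_le (d : measure_display) (X : measurableType d) (R : realType)
    (g mu : probability X R) (phi : X -> R) : is_test phi ->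
  true_positive_rate g phi <=
  roc_bound (dTV g mu) (false_positive_rate mu phi).
Proof.
move=> tphi; have Eg := test_expectation_fin_num g tphi.
have Emu := test_expectation_fin_num mu tphi.
have := expectation_le_dTV g mu tphi; have := test_expectation_itv g tphi.
rewrite /true_positive_rate /false_positive_rate /roc_bound.
rewrite -(fineK Eg) -(fineK Emu) -EFinD !lee_fin /= => /andP[_ E1 Er].
by case: ifP.
Qed.

Section two_point.
Context (d : measure_display) (T : measurableType d) (R : realType).

Definition coin (a b : T) (h : bool) : T := if h then a else b.

Lemma measurable_coin a b : measurable_fun [set: bool] (coin a b).
Proof. by []. Qed.

HB.instance Definition _ a b :=
  isMeasurableFun.Build _ _ bool T (coin a b) (measurable_coin a b).

(** As the law of a biased coin, this is a probability measure by construction, and its expectations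
    reduce to Bernoulli integrals. *)
Definition two_point (p : R) (a b : T) : probability T R :=
  distribution (bernoulli_prob p) (coin a b).

Lemma fine_two_point p a b (S : set T) : 0 <= p <= 1 ->
  fine (two_point p a b S) = p * \1_S a + (1 - p) * \1_S b.
Proof.
by move=> p01; rewrite /two_point /distribution /pushforward /= bernoulli_probE//.
Qed.

Lemma expectation_two_point p a b (phi : T -> R) : 0 <= p <= 1 ->
  measurable_fun [set: T] phi -> (forall z, 0 <= phi z) ->
  fine ('E_(two_point p a b)[phi])%E = p * phi a + (1 - p) * phi b.
Proof.
move=> p01 mphi phi0; rewrite unlock ge0_integral_distribution//.
- rewrite integral_bernoulli_prob//=; last by move=> h; rewrite lee_fin.
- exact/measurable_EFinP.
Qed.

(** The mass at [a] cancels, leaving [1 - p] times a difference of two indicators; the set [[set b]]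
    attains the bound. *)
Lemma dTV_two_point p a b c : measurable [set b] -> b != c -> a != b ->
  0 <= p <= 1 -> dTV (two_point p a b) (two_point p a c) = 1 - p.
Proof.
move=> mb bc ab p01; apply/eqP; rewrite eq_le; apply/andP; split.
  apply: dTV_le => S mS; rewrite !fine_two_point// ler_norml !indicE.
  by case: (b \in S); case: (c \in S); rewrite /=; lra.
apply: le_trans (le_dTV _ _ mb); rewrite !fine_two_point// !indicE !in_set1.
rewrite eqxx (negbTE ab) eq_sym (negbTE bc) /= ler_normr.
by apply/orP; left; lra.
Qed.

End two_point.

(* On [nat], 0 is the common atom, 1 the private atom of [mu'] and 2 that of
   [g'].  At [r = 1] (resp. [r = 0]) the first (resp. second) quotient is the
   junk value [_ / 0 = 0], at an atom of mass 0. *)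
Definition optimal_test (R : realType) (r x : R) (z : nat) : R :=
  match z with
  | 0 => if x <= 1 - r then x / (1 - r) else 1
  | 1 => if x <= 1 - r then 0 else (x - (1 - r)) / r
  | _ => 1
  end.

Lemma optimal_test_is_test (R : realType) (r x : R) :
  0 <= r <= 1 -> 0 <= x <= 1 -> is_test (optimal_test r x).
Proof.
move=> r01 x01; split=> // -[|[|z]] /=; last by lra.
- case: ifPn => [xr|_]; last by lra.
  have [->|r1] := eqVneq (1 - r) 0; first by rewrite invr0; lra.
  have r0 : 0 < 1 - r by rewrite lt0r r1; lra.
  by rewrite divr_ge0 ?ler_pdivrMr ?mul1r//; lra.
- case: ifPn => [_|xr]; first by lra.
  have r0 : 0 < r by lra.
  by rewrite divr_ge0 ?ler_pdivrMr ?mul1r//; lra.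
Qed.

(** The common atom contributes equally to both rates. For [x <= 1 - r] it contributes [x], and the
    private atoms add 0 and [r]; for larger [x] it contributes [1 - r], and they add [x - (1 - r)]
    and [r]. *)
Lemma optimal_test_rates (R : realType) (r x : R) :
  0 <= r <= 1 -> 0 <= x <= 1 ->
  false_positive_rate (two_point (1 - r) 0%N 1%N) (optimal_test r x) = x /\
  true_positive_rate (two_point (1 - r) 0%N 2%N) (optimal_test r x)
    = roc_bound r x.
Proof.
move=> r01 x01; have [mt t01] := optimal_test_is_test r01 x01.
have t0 z : 0 <= optimal_test r x z by case/andP: (t01 z).
have p01 : 0 <= 1 - r <= 1 by lra.
rewrite /false_positive_rate /true_positive_rate !expectation_two_point//=.
rewrite /roc_bound; case: ifPn => xr; last first.
  (* Here [1 - r < x <= 1], so the division by [r] is genuine. *)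
  have r0 : r != 0 by lra.
  by split; [field|lra].
have -> : (1 - r) * (x / (1 - r)) = x; last by split; lra.
(* When [1 - r = 0], the branch condition forces [x = 0], which the junk quotient still yields. *)
have [r0|r0] := eqVneq (1 - r) 0; last by field.
by rewrite r0 mul0r; lra.
Qed.

Theorem proposition3 (R : realType) (d : measure_display)
    (X : measurableType d) (g_alpha mu : probability X R) (r : R)
    (hr : r = dTV g_alpha mu) :
  (forall A : R -> X -> R, is_attack_policy mu A ->
     forall x : R, 0 <= x <= 1 -> roc_curve g_alpha A x <= roc_bound r x)
  /\
  (exists (d' : measure_display) (X' : measurableType d')
          (mu' g' : probability X' R),
     dTV mu' g' = r /\
     exists A : R -> X' -> R, is_attack_policy mu' A /\
       forall x : R, 0 <= x <= 1 -> roc_curve g' A x = roc_bound r x).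
Proof.
split=> [A polA x x01|].
  (* Only the argument of [roc_bound] becomes the false positive rate; the index of [A] stays
     [x]. *)
  have [tA {2}<-] := polA x x01; rewrite hr; exact: test_roc_le.
have r01 : 0 <= r <= 1 by rewrite hr; exact: dTV_itv.
exists default_measure_display, nat.
exists (two_point (1 - r) 0%N 1%N), (two_point (1 - r) 0%N 2%N); split.
  by rewrite dTV_two_point ?subKr//; lra.
exists (optimal_test r); split=> x x01; last first.
  by case: (optimal_test_rates r01 x01).
by split; [exact: optimal_test_is_test|case: (optimal_test_rates r01 x01)].
Qed.
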